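(* Let $\boldsymbol{\alpha}=(\alpha_1,\dots,\alpha_r)$ and $\boldsymbol{\beta}=(\beta_1,\dots,\beta_r)$ be tuples of parameters in $\mathbb{Q}\setminus\mathbb{Z}_{\leq 0}$ such that $\mathcal{F}_{\boldsymbol{\alpha},\boldsymbol{\beta}}$ is globally bounded. Then $\mathcal{F}_{\boldsymbol{\alpha},\boldsymbol{\beta}}$ has the Gauss property if and only if it is factorial. Furthermore, in the latter case, if $\mathcal{F}_{\boldsymbol{\alpha},\boldsymbol{\beta}}(Cx)=F_{\mathbf{e},\mathbf{f}}(x)$ for some non-zero $C\in\mathbb{Q}$ and some tuples of positive integers $\mathbf{e},\mathbf{f}$, then $F_{\mathbf{e},\mathbf{f}}$ satisfies Gauss congruences for all prime numbers $p$.
   Context: Let $(\alpha)_n:=\alpha(\alpha+1)\cdots(\alpha+n-1)$ for $n\ge 1$ and $(\alpha)_0:=1$. Put $$\mathcal{F}_{\boldsymbol{\alpha},\boldsymbol{\beta}}(x):=\sum_{n=0}^\infty\frac{(\alpha_1)_n\cdots(\alpha_r)_n}{(\beta_1)_n\cdots(\beta_r)_n}\,x^n .$$ For tuples of positive integers $\mathbf{e}=(e_1,\dots,e_u)$ and $\mathbf{f}=(f_1,\dots,f_v)$ put $$F_{\mathbf{e},\mathbf{f}}(x):=\sum_{n=0}^\infty \frac{(e_1 n)!\cdots (e_u n)!}{(f_1 n)!\cdots (f_v n)!}\,x^n .$$ $\mathcal{F}_{\boldsymbol{\alpha},\boldsymbol{\beta}}$ is called factorial if there exist a non-zero $C\in\mathbb{Q}$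 and tuples of positive integers $\mathbf{e},\mathbf{f}$ with $\mathcal{F}_{\boldsymbol{\alpha},\boldsymbol{\beta}}(Cx)=F_{\mathbf{e},\mathbf{f}}(x)$ (since $\boldsymbol{\alpha}$ and $\boldsymbol{\beta}$ have the same length, one then necessarily has $\sum_j e_j=\sum_j f_j$). A series $f(x)\in\mathbb{Q}[[x]]$ is globally bounded if it has a non-zero radius of convergence and there exist $C,D\in\mathbb{Q}\setminus\{0\}$ such that $D\cdot f(Cx)\in\mathbb{Z}[[x]]$. For a prime $p$, let $\mathbb{Z}_{(p)}=\{r\in\mathbb{Q}: v_p(r)\ge 0\}$, where $v_p$ is the $p$-adic valuation. A series $\sum_{n\ge0}a_nx^n\in\mathbb{Q}[[x]]$ satisfies Gauss congruences for the prime $p$ if $a_{np}-a_n\in np\,\mathbb{Z}_{(p)}$ for all integers $n$ (with $a_n:=0$ for $n<0$). It has the Gauss property if it satisfies Gauss congruences for all but finitely many primes $p$. *)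

(* Defs.v *)
From HB Require Import structures.
From mathcomp Require Import all_boot all_order all_algebra.
From mathcomp Require Import all_classical all_reals all_analysis.

Set Implicit Arguments.
Unset Strict Implicit.
Unset Printing Implicit Defensive.
Import Order.TTheory GRing.Theory Num.Theory.
Import numFieldNormedType.Exports.

Local Open Scope classical_set_scope.
Local Open Scope ring_scope.

(* A formal power series over the rationals is its sequence of coefficients. *)
Definition Qseries := nat -> rat.

(* The series f(C x). *)
Definition dilate (C : rat) (f : Qseries) : Qseries := fun n => C ^+ n * f n.

Definition pochhammer (a : rat) (n : nat) : rat := \prod_(i < n) (a + i%:R).

Definition hypergeom (r : nat) (alpha beta : r.-tuple rat) : Qseries := fun n =>
  (\prod_(i < r) pochhammer (tnth alpha i) n)
    / (\prod_(i < r) pochhammer (tnth beta i) n).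

Definition factorial_ratio (e f : seq nat) : Qseries := fun n =>
  (\prod_(j <- e) ((j * n)`!)%:R) / (\prod_(j <- f) ((j * n)`!)%:R).

Definition positive_seq (e : seq nat) : bool := all (fun j => 0 < j)%N e.

Definition factorial_hypergeom (r : nat) (alpha beta : r.-tuple rat) : Prop :=
  exists C : rat, exists e f : seq nat,
    [/\ C != 0, positive_seq e, positive_seq f
      & dilate C (hypergeom alpha beta) = factorial_ratio e f].

Definition nonpos_int : pred rat := [pred a | (a \is a Num.int) && (a <= 0)].

(* Testing convergence at real points only gives the same radius as testing at
   complex points. *)
Definition radius_of_convergence (R : realType) (f : Qseries) : \bar R :=
  ereal_sup [set (`|x|)%:E
            | x in [set x : R | cvgn (pseries (fun n => ratr (f n)) x)]].

Definition globally_bounded (R : realType) (f : Qseries) : Prop :=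
  radius_of_convergence R f <> 0%E /\
  exists C D : rat,
    [/\ C != 0, D != 0 & forall n, D * dilate C f n \is a Num.int].

(* Only meaningful for x != 0; the value at 0 is a junk value. *)
Definition padic_val (p : nat) (x : rat) : int :=
  (logn p `|numq x|)%:Z - (logn p `|denq x|)%:Z.

Definition Zlocal (p : nat) : pred rat :=
  [pred x | (x == 0) || (0 <= padic_val p x)].

Definition coefz (f : Qseries) (n : int) : rat :=
  if n is Posz m then f m else 0.

Definition gauss_congruences (p : nat) (f : Qseries) : Prop :=
  forall n : int, exists2 z : rat,
    z \in Zlocal p & coefz f (n * p%:Z) - coefz f n = (n * p%:Z)%:~R * z.

Definition gauss_property (f : Qseries) : Prop :=
  finite_set [set p : nat | prime p /\ ~ gauss_congruences p f].

(* Main.v *)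
Require Import Defs.
From mathcomp Require Import all_boot all_order all_algebra.
From mathcomp Require Import all_classical all_reals all_analysis.
From mathcomp Require Import cyclic ring zify.

(** Write a_n for the n-th coefficient of the hypergeometric series and Q(n) for
that of a factorial ratio with entries e and f.

Factorial implies Gauss.  A hypergeometric term determines its parameters
([poch_prod_inj]), so an identity C^n a_n = Q(n) forces the entries of e and
of f to have the same sum, and C to be a quotient of products of j^j
([factorial_balanced]).  Removing the multiples of p from (j n p)! leaves a
product W(j n) of integers prime to p, which is congruent to W(n)^j modulo n p
([pfree_fact_mul]).  As the sums agree, Q(n p) / Q(n) is
congruent to 1 modulo n p, and the Gauss congruence at p follows as soon as
Q takes p-integral values ([factorial_ratio_gauss]).  Global boundedness gives
this integrality for large p; Landau's criterion, which reads the sign of the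
valuations of Q from one step function common to all primes, transports it to
every p ([factorial_ratio_Zlocal]).  Finally C^n and C^(n p) agree modulo n p
for large p, which lets one pass from Q to a ([gauss_dilate]).

Gauss implies factorial.  Write the parameters as x / N with x an integer.
For a large prime p, among the factors x + k N with k < n p, exactly n are
multiples of p, and dividing them by p gives t, t + N, t + 2 N and so on,
where t is the representative in [1, N] of x / p modulo N; the other factors
multiply to a residue modulo p that does not depend on x
([arith_prod_mulp]).  Hence a_(n p) is congruent modulo p to the term a'_n
whose parameters are the t / N, and the Gauss congruence reads
a'_n = a_n modulo p.  Both sides are rationals from a finite set that does not
depend on p, so for p large this is an equality for as many n as desired
([gauss_twist_eq]).  Since a term determines its parameters, the multiset of
the alpha's minus that of the beta's is supported in (0, 1] and invariant
under x -> p x modulo N for every large prime p ([gauss_twist_perm]), hence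
under multiplication by every unit modulo N, because each residue class prime
to N contains an integer all of whose prime factors are large
([rough_progression]).  The multiplicity of j / N therefore depends
only on gcd(j, N) ([count_diff_gcd]).  Such a function of j is an integral
combination of indicators of the multiples of divisors h of N
([divisor_sum_decomposition]), and for e = N / h the product of the Pochhammer
symbols of 1/e, 2/e, up to e/e is (e n)! / e^(e n).  So a_n is a factorial
ratio up to a geometric factor ([twist_invariant_factorial]). *)

Set Implicit Arguments.
Unset Strict Implicit.
Unset Printing Implicit Defensive.
Import Order.TTheory GRing.Theory Num.Theory.
Local Open Scope ring_scope.

(** * The local ring at a prime inside the rationals *)

(** Numerator and denominator are coprime, so a negative valuation can only come
from p dividing the denominator. *)
Lemma ZlocalE p x : prime p -> (x \in Zlocal p) = ~~ (p %| `|denq x|)%N.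
Proof.
move=> p_pr; rewrite inE /padic_val.
have [->|x0] := eqVneq x 0; first by rewrite dvdn1 neq_ltn prime_gt1 ?orbT.
have den0 : (0 < `|denq x|)%N by rewrite absz_gt0 denq_neq0.
rewrite subr_ge0 lez_nat /=.
have [pd|pd] := boolP (p %| `|denq x|)%N; last first.
  by rewrite lognE (negPf pd) !andbF.
have pn : ~~ (p %| `|numq x|)%N.
  apply/negP => pn; have := dvdn_gcd p `|numq x| `|denq x|.
  rewrite pn pd (eqP (coprime_num_den x)) dvdn1.
  by move/eqP => p1; rewrite p1 in p_pr.
rewrite [logn p `|numq x|]lognE (negPf pn) !andbF leqn0 lognE p_pr den0 pd.
by [].
Qed.

Lemma natr_neq0_of_ndvd p (d : nat) : ~~ (p %| d)%N -> d%:R != 0 :> rat.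
Proof. by rewrite pnatr_eq0; apply: contraNneq => ->; rewrite dvdn0. Qed.

Lemma Zlocal_frac p (a : int) (d : nat) :
  prime p -> ~~ (p %| d)%N -> a%:~R / d%:R \in Zlocal p.
Proof.
move=> p_pr pd; rewrite ZlocalE //; apply: contra pd => /dvdn_trans; apply.
have := divqP a d; set x := _ / _.
move e: (d : int) => d'; move: e => /[swap].
case=> [|k y k0]; first by rewrite dvd1n.
by move/(congr1 absz) => /= ->; rewrite abszM dvdn_mull.
Qed.

Lemma Zlocal_fracP p x : prime p ->
  reflect (exists a : int, exists2 d : nat, ~~ (p %| d)%N & x = a%:~R / d%:R)
          (x \in Zlocal p).
Proof.
move=> p_pr; apply: (iffP idP) => [|[a [d pd ->]]]; last exact: Zlocal_frac.
rewrite ZlocalE // => pd; exists (numq x), `|denq x|%N => //.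
by rewrite -[LHS]divq_num_den -absz_denq.
Qed.

Lemma Zlocal_int p (a : int) : prime p -> a%:~R \in Zlocal p.
Proof.
move=> p_pr; apply/Zlocal_fracP => //; exists a, 1%N; last by rewrite divr1.
by rewrite dvdn1 neq_ltn prime_gt1 ?orbT.
Qed.

Lemma ZlocalM p x y : prime p ->
  x \in Zlocal p -> y \in Zlocal p -> x * y \in Zlocal p.
Proof.
move=> p_pr /(Zlocal_fracP _ p_pr)[a [d pd ->]] /(Zlocal_fracP _ p_pr)[b [e pe ->]].
rewrite mulf_div -intrM -natrM Zlocal_frac //.
by rewrite Euclid_dvdM // negb_or pd.
Qed.

Lemma ZlocalD p x y : prime p ->
  x \in Zlocal p -> y \in Zlocal p -> x + y \in Zlocal p.
Proof.
move=> p_pr /(Zlocal_fracP _ p_pr)[a [d pd ->]] /(Zlocal_fracP _ p_pr)[b [e pe ->]].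
have d0 := natr_neq0_of_ndvd pd.
have e0 := natr_neq0_of_ndvd pe.
rewrite addf_div //.
have -> : a%:~R * e%:R + b%:~R * d%:R = (a * e + b * d)%:~R :> rat.
  by rewrite intrD !intrM.
by rewrite -natrM Zlocal_frac // Euclid_dvdM // negb_or pd.
Qed.

Lemma ZlocalX p x n : prime p -> x \in Zlocal p -> x ^+ n \in Zlocal p.
Proof.
move=> p_pr xp; elim: n => [|n IHn]; first exact: (Zlocal_int 1 p_pr).
by rewrite exprS ZlocalM.
Qed.

(** The denominator of z is prime to p, so clearing it does not affect
divisibility by p. *)
Lemma Zlocal_dvd p (a : int) z : prime p -> z \in Zlocal p ->
  a%:~R = p%:R * z -> (p%:Z %| a)%Z.
Proof.
move=> p_pr /(Zlocal_fracP _ p_pr)[b [d pd ->]].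
have d0 := natr_neq0_of_ndvd pd.
move=> ae; have /eqP : (a * d)%:~R = (p%:Z * b)%:~R :> rat.
  by rewrite !intrM ae -!pmulrn mulrA divfK.
rewrite eqr_int => /eqP ad.
have : (p%:Z %| a * d)%Z by rewrite ad dvdz_mulr.
by rewrite Gauss_dvdzl // coprimezE prime_coprime.
Qed.

Lemma Zlocal_of_large_prime x : exists B, forall p, prime p -> (B < p)%N -> x \in Zlocal p.
Proof.
exists `|denq x|%N => p p_pr ltp; rewrite ZlocalE //; apply/negP => /dvdn_leq.
by rewrite absz_gt0 denq_neq0 leqNgt ltp => /(_ isT).
Qed.

(** * Gauss congruences for factorial ratios *)

Lemma gauss_congruences_nat p (f : Qseries) : prime p ->
  gauss_congruences p f <->
  forall n, exists2 z, z \in Zlocal p & f (n * p)%N - f n = (n * p)%:R * z.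
Proof.
move=> p_pr; split=> [fG n|fG [n|n]].
- by have [z zp e] := fG n; exists z => //; rewrite pmulrn PoszM -e.
- by have [z zp e] := fG n; exists z => //; rewrite -PoszM -pmulrn -e.
exists 0; first exact: (Zlocal_int 0 p_pr).
have : Negz n * p%:Z < 0 by rewrite pmulr_llt0 // ltz_nat prime_gt0.
by case: (Negz n * p%:Z) => // m _; rewrite /= subr0 mulr0.
Qed.

Lemma factD a b : (a + b)`! = (a`! * \prod_(1 <= i < b.+1) (a + i))%N.
Proof.
elim: b => [|b IHb]; first by rewrite addn0 big_nil muln1.
by rewrite [in RHS]big_nat_recr //= addnS factS IHb mulnCA [X in (_ * X)%N]mulnC.
Qed.

(** For p prime, the product of the integers below m p that are prime to p.  The
blocks of length p make translation by a multiple of p a relabelling of blocks. *)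
Definition pfree_fact (p m : nat) : nat :=
  \prod_(k < m) \prod_(1 <= i < p) (k * p + i).

Lemma fact_mulp p m : (0 < p)%N -> ((m * p)`! = p ^ m * m`! * pfree_fact p m)%N.
Proof.
move=> p0; elim: m => [|m IHm]; first by rewrite /pfree_fact big_ord0 mul0n.
have -> : (m.+1 * p = m * p + p)%N by rewrite mulSn addnC.
rewrite factD IHm /pfree_fact big_ord_recr /= big_nat_recr //= expnS factS.
by rewrite -mulSnr -!mulnA; lia.
Qed.

Lemma pfree_fact_ndvd p m : prime p -> ~~ (p %| pfree_fact p m)%N.
Proof.
move=> p_pr; rewrite /pfree_fact.
elim/big_ind: _ => [|x y px py|k _]; rewrite ?Euclid_dvd1 ?Euclid_dvdM ?negb_or ?px //.
rewrite big_nat; elim/big_ind: _ => [|x y px py|i /andP[i0 ip]].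
- by rewrite Euclid_dvd1.
- by rewrite Euclid_dvdM // negb_or px.
by rewrite dvdn_addr ?dvdn_mull // gtnNdvd.
Qed.

(** The integers below j n p split into j intervals of length n p, which are
translates of one another modulo n p. *)
Lemma pfree_fact_mul p n j :
  pfree_fact p (j * n) = pfree_fact p n ^ j %[mod n * p].
Proof.
elim: j => [|j IHj]; first by rewrite /pfree_fact big_ord0.
have -> : pfree_fact p (j.+1 * n) = (pfree_fact p (j * n) *
    \prod_(k < n) \prod_(1 <= i < p) ((j * n + k) * p + i))%N.
  by rewrite mulSnr /pfree_fact big_split_ord.
rewrite expnSr -modnMml IHj modnMml -modnMmr -[in RHS]modnMmr; congr ((_ * _) %% _)%N.
rewrite /pfree_fact; elim/big_rec2: _ => // k x y _ xy; rewrite -modnMmr xy modnMmr.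
rewrite -modnMml -[in RHS]modnMml; congr ((_ * _) %% _)%N.
elim/big_rec2: _ => // i {xy}x {}y _ xy; rewrite -modnMmr xy modnMmr.
by rewrite -modnMml -[in RHS]modnMml /= mulnDl -mulnA -addnA modnMDl.
Qed.

Definition fact_prod (e : seq nat) (n : nat) : nat := \prod_(j <- e) (j * n)`!.

Lemma factorial_ratioE e f n :
  factorial_ratio e f n = (fact_prod e n)%:R / (fact_prod f n)%:R.
Proof. by rewrite /factorial_ratio /fact_prod !natr_prod. Qed.

Lemma fact_prod_gt0 e n : (0 < fact_prod e n)%N.
Proof. by rewrite prodn_gt0 // => j; rewrite fact_gt0. Qed.

Lemma fact_prod_neq0 e n : (fact_prod e n)%:R != 0 :> rat.
Proof. by rewrite pnatr_eq0 -lt0n fact_prod_gt0. Qed.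

Lemma fact_prod_mulp p e n : (0 < p)%N ->
  fact_prod e (n * p) =
    (p ^ (sumn e * n) * fact_prod e n * \prod_(j <- e) pfree_fact p (j * n))%N.
Proof.
move=> p0; rewrite /fact_prod; elim: e => [|j e IHe]; first by rewrite !big_nil.
rewrite !big_cons IHe (mulnA j) fact_mulp //=.
rewrite mulnDl expnD; move: (p ^ (j * n))%N (p ^ (sumn e * n))%N => x y; ring.
Qed.

Lemma prod_pfree_fact_mod p e n :
  \prod_(j <- e) pfree_fact p (j * n) = pfree_fact p n ^ sumn e %[mod n * p].
Proof.
elim: e => [|j e IHe]; first by rewrite big_nil.
by rewrite big_cons -modnMmr IHe modnMmr -modnMml pfree_fact_mul modnMml expnD.
Qed.

Lemma prod_pfree_fact_ndvd p e n : prime p ->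
  ~~ (p %| \prod_(j <- e) pfree_fact p (j * n))%N.
Proof.
move=> p_pr; elim/big_ind: _ => [|x y px py|k _].
- by rewrite Euclid_dvd1.
- by rewrite Euclid_dvdM // negb_or px.
exact: pfree_fact_ndvd.
Qed.

(** Passing from n to n p multiplies both numerator and denominator by the same
power of p, because the sums agree, and by products of integers prime to p
that are congruent modulo n p. *)
Lemma factorial_ratio_gauss p e f : prime p -> sumn e = sumn f ->
  (forall n, factorial_ratio e f n \in Zlocal p) ->
  gauss_congruences p (factorial_ratio e f).
Proof.
move=> p_pr sef Qint; apply/gauss_congruences_nat => // n.
set A := (\prod_(j <- e) pfree_fact p (j * n))%N.
set B := (\prod_(j <- f) pfree_fact p (j * n))%N.
have pB : ~~ (p %| B)%N by apply: prod_pfree_fact_ndvd.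
have B0 := natr_neq0_of_ndvd pB.
have /dvdzP[t ABt] : ((n * p)%:Z %| A%:Z - B%:Z)%Z.
  rewrite -eqz_mod_dvd; apply/eqP; rewrite !modz_nat.
  by rewrite /A /B !prod_pfree_fact_mod sef.
exists (factorial_ratio e f n * (t%:~R / B%:R)).
  by rewrite ZlocalM ?Zlocal_frac.
have p0 : (p ^ (sumn f * n))%:R != 0 :> rat.
  by rewrite pnatr_eq0 -lt0n expn_gt0 prime_gt0.
have -> : (n * p)%:R * (factorial_ratio e f n * (t%:~R / B%:R)) =
    factorial_ratio e f n * ((A%:Z - B%:Z)%:~R / B%:R).
  by rewrite ABt intrM -pmulrn; ring.
rewrite !factorial_ratioE !fact_prod_mulp ?prime_gt0 // sef -/A -/B.
rewrite !natrM intrD intrN -!pmulrn.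
by field; rewrite B0 p0 fact_prod_neq0.
Qed.

(** * Landau's integrality criterion *)

Lemma Zlocal_nat_frac p a b : prime p -> (0 < a)%N -> (0 < b)%N ->
  (a%:R / b%:R \in Zlocal p) = (logn p b <= logn p a)%N.
Proof.
move=> p_pr a0 b0; have b0' : b%:R != 0 :> rat by rewrite pnatr_eq0 -lt0n.
apply/Zlocal_fracP/idP => // [[A [d pd /eqP]]|leba].
  rewrite eqr_div ?(natr_neq0_of_ndvd pd) // -[d%:R]/(d%:Z%:~R) -[a%:R]/(a%:Z%:~R).
  rewrite -[b%:R]/(b%:Z%:~R) -!intrM eqr_int => /eqP/(congr1 absz).
  rewrite !abszM /= => adAb.
  have d0 : (0 < d)%N by case: d pd {adAb} => //; rewrite dvdn0.
  have A0 : (0 < `|A|)%N by move: (muln_gt0 a d); rewrite adAb muln_gt0 a0 d0 => /andP[].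
  have := congr1 (logn p) adAb; rewrite !lognM //.
  by rewrite [logn p d]lognE (negPf pd) !andbF addn0 => ->; rewrite leq_addl.
have [a' pa' ea] := pfactor_coprime p_pr a0.
have [b' pb' eb] := pfactor_coprime p_pr b0.
exists (a' * p ^ (logn p a - logn p b))%N, b'; first by rewrite -prime_coprime.
rewrite [in LHS]ea [in LHS]eb -(subnK leba) expnD mulnA !natrM.
have p0 : (p ^ logn p b)%:R != 0 :> rat by rewrite pnatr_eq0 -lt0n expn_gt0 prime_gt0.
by rewrite -mulf_div divff // mulr1 subnK // -pmulrn natrM.
Qed.

Lemma logn_fact_wide p m K : prime p -> (m < K)%N ->
  logn p m`! = (\sum_(1 <= k < K) m %/ p ^ k)%N.
Proof.
move=> p_pr mK; rewrite logn_fact // [RHS](big_cat_nat (n:=m.+1)) //=.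
rewrite [X in (_ + X)%N](_ : _ = 0%N) ?addn0 // big_nat_cond big1 // => k.
case/andP=> [/andP[mk _] _].
by rewrite divn_small // (leq_trans mk) // ltnW // ltn_expl // prime_gt1.
Qed.

Lemma logn_fact_small p m : prime p -> (m < p ^ 2)%N -> logn p m`! = (m %/ p)%N.
Proof.
move=> p_pr mp; rewrite (@logn_fact_wide _ _ m.+2) // big_ltn // expn1.
rewrite big_nat_cond big1 ?addn0 // => k /andP[/andP[k2 _] _].
by rewrite divn_small // (leq_trans mp) // leq_exp2l // prime_gt1.
Qed.

Lemma logn_prod_fact p e n :
  logn p (fact_prod e n) = (\sum_(j <- e) logn p (j * n)`!)%N.
Proof.
rewrite /fact_prod; elim: e => [|j e IHe]; first by rewrite !big_nil logn1.
by rewrite !big_cons lognM ?fact_gt0 ?IHe // fact_prod_gt0.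
Qed.

Lemma leq_sumn j e : j \in e -> (j <= sumn e)%N.
Proof. by move=> je; rewrite sumnE (big_rem j je) leq_addr. Qed.

Lemma sum_divn_modn e n N : (0 < N)%N ->
  (\sum_(j <- e) (j * n) %/ N = sumn e * (n %/ N) + \sum_(j <- e) (j * (n %% N)) %/ N)%N.
Proof.
move=> N0; elim: e => [|j e IHe]; first by rewrite !big_nil.
by rewrite !big_cons IHe /= {1}(divn_eq n N) mulnDr mulnA divnMDl //; lia.
Qed.

(** With m / q just above a / N, the integer parts of j m / q and j a / N agree
once q is large: fractional parts of j a / N stay at distance at least 1 / N
below 1, while j m / q exceeds j a / N by less than j / q. *)
Lemma divn_ceil_shift j a N q : (a < N)%N -> (j.+1 * N < q)%N ->
  let m := ((a * q + N.-1) %/ N)%N in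
  (m <= q)%N /\ ((j * m) %/ q = (j * a) %/ N)%N.
Proof.
move=> aN jNq m; have N0 : (0 < N)%N by exact: leq_ltn_trans aN.
have q0 : (0 < q)%N by exact: leq_ltn_trans jNq.
have le1 : (m * N <= a * q + N.-1)%N by rewrite leq_divM.
have le2 : (a * q + N.-1 < m.+1 * N)%N by rewrite ltn_ceil.
have mq : (m <= q)%N.
  have Nq : (N <= q)%N by rewrite (leq_trans _ (ltnW jNq)) // leq_pmull.
  have h : (a * q <= N.-1 * q)%N by rewrite leq_mul2r; lia.
  have h5 : (N.-1 * q + q = N * q)%N by rewrite -mulSnr prednK.
  by rewrite -(leq_pmul2r N0) (leq_trans le1) // [(q * N)%N]mulnC; lia.
split=> //; have := divn_eq (j * a) N; have := ltn_pmod (j * a) N0.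
move: (_ %/ N)%N (_ %% N)%N => c rho rN E.
have lo : (c * q <= j * m)%N.
  rewrite -(leq_pmul2r N0); nia.
have hi : (j * m < c.+1 * q)%N.
  have h1 : (j * (m * N) <= j * (a * q + N.-1))%N by rewrite leq_mul2l le1 orbT.
  have h2 : (rho * q <= N.-1 * q)%N by rewrite leq_mul2r; lia.
  have h3 : (j * (a * q) = (c * N + rho) * q)%N by rewrite mulnA E.
  have h4 : (j * N.-1 <= j * N)%N by rewrite leq_mul2l leq_pred orbT.
  have h5 : (N.-1 * q + q = N * q)%N by rewrite -mulSnr prednK.
  rewrite -(ltn_pmul2r N0) -mulnA (leq_ltn_trans h1) // mulnDr h3 mulSn.
  rewrite mulnDl mulnDl [(q * N)%N]mulnC [(c * q * N)%N]mulnAC; lia.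
have -> : (j * m = c * q + (j * m - c * q))%N by rewrite subnKC.
by rewrite divnMDl // divn_small ?addn0 // ltn_subLR // -mulSnr.
Qed.

(** The difference of the two sums is the value at n / N of a step function of
period 1, the periodicity being due to the equality of the sums.  For a large
prime q, that value is the valuation at q of the factorial ratio at an integer
m with m / q slightly above the fractional part of n / N. *)
Lemma landau_step_function e f B : sumn e = sumn f ->
  (forall q, prime q -> (B < q)%N -> forall n, factorial_ratio e f n \in Zlocal q) ->
  forall N n, (0 < N)%N ->
  (\sum_(j <- f) (j * n) %/ N <= \sum_(j <- e) (j * n) %/ N)%N.
Proof.
move=> sef large N n N0; rewrite (sum_divn_modn f n) // (sum_divn_modn e n) // sef leq_add2l.
have := ltn_pmod n N0; move: (n %% N)%N => a aN.
have [q qB q_pr] := prime_above (B + (sumn f).+1 * N).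
have Bq : (B < q)%N by rewrite (leq_ltn_trans _ qB) // leq_addr.
set m := ((a * q + N.-1) %/ N)%N.
have := large q q_pr Bq m.
rewrite factorial_ratioE Zlocal_nat_frac ?fact_prod_gt0 // !logn_prod_fact.
have lognE' s : sumn s = sumn f ->
    (\sum_(j <- s) logn q (j * m)`! = \sum_(j <- s) (j * a) %/ N)%N.
  move=> ssf; apply: eq_big_seq => j js.
  have jN : (j.+1 * N < q)%N.
    rewrite (leq_ltn_trans _ qB) // -ssf (leq_trans _ (leq_addl _ _)) //.
    by rewrite leq_mul2r ltnS leq_sumn ?orbT.
  have [mq <-] := divn_ceil_shift aN jN.
  (* Since j m < q^2, Legendre's formula has a single term. *)
  rewrite logn_fact_small // expnS expn1.
  rewrite (@leq_ltn_trans (j * q)) ?leq_mul2l ?mq ?orbT //.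
  by rewrite ltn_pmul2r ?prime_gt0 // (leq_trans _ (ltnW jN)) // leq_pmulr.
by rewrite !lognE'.
Qed.

(** By Legendre's formula the valuation at p is a sum of values, at the points
n / p^k, of a function that is nonnegative by [landau_step_function]. *)
Lemma factorial_ratio_Zlocal e f B : sumn e = sumn f ->
  (forall q, prime q -> (B < q)%N -> forall n, factorial_ratio e f n \in Zlocal q) ->
  forall p n, prime p -> factorial_ratio e f n \in Zlocal p.
Proof.
move=> sef large p n p_pr.
rewrite factorial_ratioE Zlocal_nat_frac ?fact_prod_gt0 // !logn_prod_fact.
have lognE' s : sumn s = sumn f -> (\sum_(j <- s) logn p (j * n)`! =
    \sum_(1 <= k < (sumn f * n).+1) \sum_(j <- s) (j * n) %/ p ^ k)%N.
  move=> ssf; rewrite exchange_big; apply: eq_big_seq => j js.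
  by rewrite -logn_fact_wide // ltnS leq_mul2r -ssf leq_sumn ?orbT.
rewrite !lognE' //; apply: leq_sum => k _.
by apply: (landau_step_function sef large); rewrite expn_gt0 prime_gt0.
Qed.

(** * Hypergeometric terms and their parameters *)

Lemma pochhammerS a n : pochhammer a n.+1 = pochhammer a n * (a + n%:R).
Proof. exact: big_ord_recr. Qed.

Lemma pochhammer0 a : pochhammer a 0 = 1.
Proof. exact: big_ord0. Qed.

Lemma pochhammer_neq0 a n : a \notin nonpos_int -> pochhammer a n != 0.
Proof.
move=> a_ok; apply/prodf_neq0 => i _; apply: contra a_ok; rewrite addr_eq0 => /eqP->.
by rewrite inE rpredN rpred_nat oppr_le0 ler0n.
Qed.

Definition poch_prod (s : seq rat) (n : nat) : rat := \prod_(x <- s) pochhammer x n.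

(** The condition under which no Pochhammer symbol vanishes. *)
Definition admissible (s : seq rat) : bool := all [predC nonpos_int] s.

Lemma admissible_cat s t : admissible (s ++ t) = admissible s && admissible t.
Proof. exact: all_cat. Qed.

Lemma poch_prod_neq0 s n : admissible s -> poch_prod s n != 0.
Proof.
move=> /allP s_ok; rewrite /poch_prod big_seq prodf_seq_neq0; apply/allP => x xs.
by apply/implyP => _; exact/pochhammer_neq0/(s_ok x xs).
Qed.

Lemma poch_prodS s n : poch_prod s n.+1 = poch_prod s n * \prod_(x <- s) (x + n%:R).
Proof. by rewrite /poch_prod -big_split; apply: eq_bigr => x _; rewrite pochhammerS. Qed.

Lemma poch_prod0 s : poch_prod s 0 = 1.
Proof. by rewrite /poch_prod big1 // => x _; rewrite pochhammer0. Qed.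

Lemma poch_prod_cat s t n : poch_prod (s ++ t) n = poch_prod s n * poch_prod t n.
Proof. by rewrite /poch_prod big_cat. Qed.

Lemma hypergeomE r (alpha beta : r.-tuple rat) n :
  hypergeom alpha beta n = poch_prod alpha n / poch_prod beta n.
Proof. by rewrite /poch_prod !big_tuple. Qed.

Lemma poly_eq_nat (p q : {poly rat}) K : (size p <= K)%N -> (size q <= K)%N ->
  (forall n, (n < K)%N -> p.[n%:R] = q.[n%:R]) -> p = q.
Proof.
move=> szp szq epq; apply/eqP; rewrite -subr_eq0.
apply/eqP/(@roots_geq_poly_eq0 _ _ [seq n%:R | n <- iota 0 K]).
- apply/allP => x /mapP[n]; rewrite mem_iota add0n /= => nK ->.
  by rewrite rootE hornerD hornerN epq // subrr.
- by rewrite map_inj_uniq ?iota_uniq // => m n /eqP; rewrite eqr_nat => /eqP.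
rewrite size_map size_iota (leq_trans (size_polyD _ _)) // size_polyN.
by rewrite geq_max szp szq.
Qed.

(** Quotients of consecutive terms are values at n of products of linear factors;
finitely many n determine these polynomials, whose leading coefficients give l
and whose roots give the parameters. *)
Lemma poch_prod_inj s t (l : rat) K : admissible s -> admissible t ->
  (size s < K)%N -> (size t < K)%N -> l != 0 ->
  (forall n, (n <= K)%N -> l ^+ n * poch_prod s n = poch_prod t n) -> l = 1 /\ perm_eq s t.
Proof.
move=> s_ok t_ok sK tK l0 est.
pose P (u : seq rat) := \prod_(x <- [seq - x | x <- u]) ('X - x%:P).
have PE u n : (P u).[n%:R] = \prod_(x <- u) (x + n%:R).
  rewrite /P horner_prod big_map; apply: eq_bigr => x _.
  by rewrite !hornerE opprK addrC.
have sP u : size (P u) = (size u).+1 by rewrite size_prod_XsubC size_map.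
have ePst : l *: P s = P t.
  apply: (@poly_eq_nat _ _ K); rewrite ?size_scale ?sP // => n nK.
  rewrite hornerZ !PE.
  have := est _ nK; rewrite !poch_prodS exprS -(est n (ltnW nK)) => e.
  apply: (mulfI (_ : l ^+ n * poch_prod s n != 0)).
    by rewrite mulf_neq0 ?expf_neq0 ?poch_prod_neq0.
  by rewrite -e; ring.
(* Both products are monic. *)
have l1 : l = 1.
  by have := congr1 lead_coef ePst; rewrite lead_coefZ !lead_coef_prod_XsubC mulr1.
split=> //; move: ePst; rewrite l1 scale1r => /prod_XsubC_eq.
by apply: perm_map_inj => x y /oppr_inj.
Qed.

(** The parameters 1/j, 2/j, up to j/j of the sequence n -> (j n)!. *)
Definition mult_params (j : nat) : seq rat := [seq k%:R / j%:R | k <- iota 1 j].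

Definition fact_params (e : seq nat) : seq rat := flatten (map mult_params e).

Definition fact_const (e : seq nat) : nat := \prod_(j <- e) j ^ j.

(** Gauss multiplication formula for the Gamma function, at integers. *)
Lemma fact_mult_pochhammer j n : (0 < j)%N ->
  ((j * n)`!)%:R = (j%:R ^+ j) ^+ n * poch_prod (mult_params j) n.
Proof.
move=> j0; have j0' : j%:R != 0 :> rat by rewrite pnatr_eq0 -lt0n.
elim: n => [|n IHn]; first by rewrite muln0 poch_prod0 mulr1.
rewrite mulnSr factD natrM IHn poch_prodS exprSr -!mulrA; congr (_ * _).
rewrite mulrCA; congr (_ * _).
rewrite natr_prod /mult_params big_map /index_iota subSS subn0.
have -> : j%:R ^+ j = \prod_(k <- iota 1 j) j%:R :> rat.
  by rewrite big_const_seq count_predT size_iota iter_mulr_1.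
rewrite -big_split; apply: eq_bigr => k _ /=.
by rewrite natrD natrM mulrDr mulrCA divff // mulr1 addrC.
Qed.

Lemma fact_prod_pochhammer e n : positive_seq e ->
  (fact_prod e n)%:R = (fact_const e)%:R ^+ n * poch_prod (fact_params e) n.
Proof.
rewrite /fact_prod /fact_const /fact_params.
elim: e => [|j e IHe] /=; first by rewrite !big_nil expr1n /poch_prod big_nil mulr1.
case/andP=> j0 e0; rewrite !big_cons !natrM IHe // fact_mult_pochhammer // natrX.
by rewrite poch_prod_cat exprMn; ring.
Qed.

Lemma size_fact_params e : size (fact_params e) = sumn e.
Proof.
rewrite /fact_params size_flatten /shape -map_comp; congr sumn.
by rewrite -[RHS]map_id; apply: eq_map => j /=; rewrite size_map size_iota.
Qed.

Lemma admissible_fact_params e : positive_seq e -> admissible (fact_params e).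
Proof.
move=> /allP e0; apply/allP => x /flattenP[_ /mapP[j je ->] /mapP[k k1 ->]].
move: k1; rewrite mem_iota => /andP[k1 _].
rewrite /= negb_and -ltNge divr_gt0 ?ltr0n ?orbT //; exact: e0.
Qed.

Lemma fact_const_gt0 e : positive_seq e -> (0 < fact_const e)%N.
Proof.
by move=> /allP e0; rewrite /fact_const big_seq prodn_cond_gt0 // => j /e0 j0; rewrite expn_gt0 j0.
Qed.

Lemma fact_const_neq0 e : positive_seq e -> (fact_const e)%:R != 0 :> rat.
Proof. by move=> e0; rewrite pnatr_eq0 -lt0n fact_const_gt0. Qed.

Lemma factorial_ratio_pochhammer e f n : positive_seq e -> positive_seq f ->
  factorial_ratio e f n = ((fact_const e)%:R / (fact_const f)%:R) ^+ n *
    (poch_prod (fact_params e) n / poch_prod (fact_params f) n).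
Proof.
by move=> e0 f0; rewrite factorial_ratioE !fact_prod_pochhammer // exprMn exprVn invfM; ring.
Qed.

(** After clearing denominators, both sides are products of Pochhammer symbols, with
the same parameters by [poch_prod_inj]; comparing their numbers gives the
equality of sums. *)
Lemma factorial_balanced r (alpha beta : r.-tuple rat) C e f :
  admissible alpha -> admissible beta -> C != 0 ->
  positive_seq e -> positive_seq f ->
  dilate C (hypergeom alpha beta) = factorial_ratio e f ->
  C = (fact_const e)%:R / (fact_const f)%:R /\ sumn e = sumn f.
Proof.
move=> a_ok b_ok C0 e0 f0 eQ.
have fe0 := fact_const_neq0 e0; have ff0 := fact_const_neq0 f0.
have [] : C * (fact_const f)%:R / (fact_const e)%:R = 1 /\
    perm_eq (alpha ++ fact_params f) (beta ++ fact_params e).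
  apply: (@poch_prod_inj _ _ _ (r + sumn e + sumn f).+1); rewrite ?admissible_cat.
  - by rewrite a_ok admissible_fact_params.
  - by rewrite b_ok admissible_fact_params.
  - by rewrite size_cat size_tuple size_fact_params; lia.
  - by rewrite size_cat size_tuple size_fact_params; lia.
  - by rewrite !mulf_neq0 ?invr_eq0.
  move=> n _; have := congr1 (fun F => F n) eQ.
  rewrite /dilate hypergeomE factorial_ratio_pochhammer // !poch_prod_cat.
  rewrite !exprMn !exprVn.
  have := poch_prod_neq0 n a_ok; have := poch_prod_neq0 n b_ok.
  have := poch_prod_neq0 n (admissible_fact_params e0).
  have := poch_prod_neq0 n (admissible_fact_params f0).
  have := expf_neq0 n fe0; have := expf_neq0 n ff0.
  move: (poch_prod alpha n) (poch_prod beta n).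
  move: (poch_prod (fact_params e) n) (poch_prod (fact_params f) n).
  move: ((fact_const e)%:R ^+ n) ((fact_const f)%:R ^+ n) (C ^+ n) => ke kf c pe pf pa pb.
  move=> kf0 ke0 pf0 pe0 pb0 pa0 eqn.
  have -> : c * kf / ke * (pa * pf) = c * (pa / pb) * (kf / ke * pf * pb) by field; rewrite ke0.
  by rewrite eqn; field; rewrite ?ke0 ?kf0 ?pf0 ?pb0 ?pe0 ?pa0.
move=> eC /perm_size; rewrite !size_cat !size_tuple !size_fact_params => /addnI ->.
by split=> //; rewrite -[(fact_const e)%:R]mul1r -eC; field; rewrite fe0 ff0.
Qed.

(** * From factorial to Gauss *)

Lemma globally_bounded_Zlocal (R : realType) r (alpha beta : r.-tuple rat) C e f :
  globally_bounded R (hypergeom alpha beta) -> C != 0 ->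
  dilate C (hypergeom alpha beta) = factorial_ratio e f ->
  exists B, forall q, prime q -> (B < q)%N ->
    forall n, factorial_ratio e f n \in Zlocal q.
Proof.
move=> [_ [E [D [E0 D0 Dint]]]] C0 eQ.
have [B1 HB1] := Zlocal_of_large_prime (C / E).
have [B2 HB2] := Zlocal_of_large_prime D^-1.
exists (B1 + B2)%N => q q_pr Bq n.
rewrite -eQ; have /intrP[z ez] := Dint n.
have -> : dilate C (hypergeom alpha beta) n = (C / E) ^+ n * (D^-1 * z%:~R).
  rewrite -ez /dilate exprMn exprVn; field.
  by rewrite D0 expf_neq0.
have q1 : (B1 < q)%N by rewrite (leq_ltn_trans _ Bq) // leq_addr.
have q2 : (B2 < q)%N by rewrite (leq_ltn_trans _ Bq) // leq_addl.
by rewrite ZlocalM ?ZlocalX ?HB1 // ZlocalM ?HB2 ?Zlocal_int.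
Qed.

(** Euler's theorem modulo the power of p that divides n p exactly. *)
Lemma expn_mulp_mod p a n : prime p -> ~~ (p %| a)%N -> (0 < n)%N ->
  a ^ (n * p) = a ^ n %[mod p ^ (logn p n).+1].
Proof.
move=> p_pr pa n0; have [m pm en] := pfactor_coprime p_pr n0.
set s := logn p n in en *; rewrite en.
have cop : coprime (a ^ m) (p ^ s.+1).
  by rewrite coprimeXl // coprimeXr // coprime_sym prime_coprime.
have := Euler_exp_totient cop; rewrite totient_pfactor //= => Eul.
have -> : (m * p ^ s * p = m * (p.-1 * p ^ s) + m * p ^ s)%N.
  by rewrite -{2}(prednK (prime_gt0 p_pr)) mulnS; lia.
by rewrite expnD expnM -modnMml Eul modnMml mul1n.
Qed.

Lemma exp_ratio_gauss p a b n : prime p -> ~~ (p %| a)%N -> ~~ (p %| b)%N ->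
  exists2 z, z \in Zlocal p &
    (a%:R / b%:R) ^+ (n * p) - (a%:R / b%:R) ^+ n = (n * p)%:R * z.
Proof.
move=> p_pr pa pb; case: (posnP n) => [->|n0].
  by exists 0; [exact: (Zlocal_int 0 p_pr) | rewrite subrr mulr0].
have b0 := natr_neq0_of_ndvd pb.
have [m] := pfactor_coprime p_pr n0; rewrite prime_coprime // => pm en.
set s := logn p n in en.
have /dvdzP[t et] : ((p ^ s.+1)%:Z %|
    (a ^ (n * p) * b ^ n)%N%:Z - (a ^ n * b ^ (n * p))%N%:Z)%Z.
  rewrite -eqz_mod_dvd; apply/eqP; rewrite !modz_nat; congr (_%:Z).
  by rewrite -modnMml -[in RHS]modnMmr !expn_mulp_mod // modnMml modnMmr.
exists (t%:~R / (m * (b ^ n * b ^ (n * p)))%:R).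
  by rewrite Zlocal_frac // !Euclid_dvdM // !Euclid_dvdX // (negPf pm) (negPf pb).
have m0 := natr_neq0_of_ndvd pm.
have enp : (n * p)%:R = (p ^ s.+1)%:R * m%:R :> rat.
  by rewrite -natrM {1}en expnSr; congr (_%:R); lia.
have e2 : (a%:R ^+ (n * p) * b%:R ^+ n) - (a%:R ^+ n * b%:R ^+ (n * p)) =
    t%:~R * (p ^ s.+1)%:R :> rat.
  have := congr1 (fun x : int => x%:~R : rat) et.
  by rewrite intrM rmorphB /= -!pmulrn !natrM !(natrX _ a, natrX _ b).
rewrite enp !exprMn !exprVn natrM [(b ^ n * _)%:R]natrM (natrX _ b n) (natrX _ b (n * p)).
move: (expf_neq0 (n * p) b0) (expf_neq0 n b0) e2.
move: (b%:R ^+ (n * p)) (b%:R ^+ n) (a%:R ^+ (n * p)) (a%:R ^+ n) => b1 b2 a1 a2.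
move: m%:R m0 (p ^ s.+1)%:R t%:~R => m' m0 q t' b10 b20 e2.
transitivity ((a1 * b2 - a2 * b1) / (b1 * b2)); first by field; rewrite b10 b20.
by rewrite e2; field; rewrite m0 b10 b20.
Qed.

(** The terms of the geometric sequence satisfy Gauss congruences themselves, and
a product rule for finite differences combines both congruences. *)
Lemma gauss_dilate p a b (f g : Qseries) : prime p ->
  ~~ (p %| a)%N -> ~~ (p %| b)%N -> (forall n, f n \in Zlocal p) ->
  (forall n, g n = (a%:R / b%:R) ^+ n * f n) ->
  gauss_congruences p f -> gauss_congruences p g.
Proof.
move=> p_pr pa pb fint eg /(gauss_congruences_nat _ p_pr) fG.
apply/gauss_congruences_nat => // n.
have [z zp ez] := fG n; have [y yp ey] := exp_ratio_gauss n p_pr pa pb.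
exists ((a%:R / b%:R) ^+ (n * p) * z + y * f n).
  by rewrite ZlocalD // ZlocalM // ZlocalX // (Zlocal_frac a).
rewrite !eg; set G := a%:R / b%:R in ey *.
rewrite mulrDr mulrCA -ez mulrA -ey; ring.
Qed.

Lemma finite_gauss_exceptions (f : Qseries) B :
  (forall p, prime p -> (B < p)%N -> gauss_congruences p f) -> gauss_property f.
Proof.
move=> fG; apply: (@sub_finite_set _ _ `I_B.+1); last exact: finite_II.
move=> p [p_pr nG] /=; rewrite ltnS leqNgt; apply/negP => Bp.
exact/nG/fG.
Qed.

(** * Products along an arithmetic progression modulo a prime *)

Definition arith_prod (N : nat) (x : int) (n : nat) : int :=
  \prod_(k < n) (x + (k * N)%:Z).

Definition prod_arith (N : nat) (s : seq int) (n : nat) : int :=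
  \prod_(x <- s) arith_prod N x n.

(** The representative of x modulo N in the interval [1, N], rather than in
[0, N - 1]: this is what the parameters x / N in (0, 1] call for. *)
Definition rep (N : nat) (x : int) : int := ((x - 1) %% N)%Z + 1.

Lemma rep_bounds (N : nat) x : (0 < N)%N -> 1 <= rep N x <= N%:Z.
Proof.
move=> N0; have N0' : N%:Z != 0 by rewrite eqz_nat -lt0n.
by rewrite /rep lerDr modz_ge0 //= -ltzD1 ltrD2r ltz_pmod.
Qed.

Lemma dvdz_rep (N : nat) x : (N %| rep N x - x)%Z.
Proof.
rewrite /rep {2}[x](_ : x = (x - 1) + 1); last by rewrite subrK.
rewrite {2}(divz_eq (x - 1) N).
by apply/dvdzP; exists (- ((x - 1) %/ N)%Z); ring.
Qed.

Lemma rep_eq (N : nat) x y : (N %| x - y)%Z -> rep N x = rep N y.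
Proof.
move=> /dvdzP[q xy]; congr (_ + 1).
by rewrite (_ : x - 1 = q * N + (y - 1)) ?modzMDl // -xy; ring.
Qed.

Lemma rep_id (N : nat) x : 1 <= x <= N%:Z -> rep N x = x.
Proof.
move=> /andP[x1 xN]; rewrite /rep modz_small ?subrK // subr_ge0 x1 /=.
by rewrite ltrBlDr (le_lt_trans xN) // ltrDl.
Qed.

Lemma prod_blocks n p (F : nat -> int) :
  \prod_(k < n * p) F k = \prod_(j < n) \prod_(i < p) F (j * p + i)%N.
Proof.
elim: n => [|n IHn]; first by rewrite !big_ord0.
by rewrite big_ord_recr /= -IHn mulSnr big_split_ord.
Qed.

Definition Fp_unit_prod (p : nat) : 'F_p := \prod_(y : 'F_p | y != 0) y.

Lemma Fp_unit_prod_neq0 p : Fp_unit_prod p != 0.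
Proof. exact/prodf_neq0. Qed.

Lemma Fp_intr_eq0 p (a : int) : prime p -> ((a%:~R : 'F_p) == 0) = (p%:Z %| a)%Z.
Proof.
by move=> p_pr; rewrite -(dvdz_pcharf (pchar_Fp p_pr)).
Qed.

(** As k runs through a full period, x + k N takes every value of the field with p
elements exactly once; discarding k0 discards the value 0.  The result does not
depend on x. *)
Lemma Fp_arith_block p (N : nat) x k0 : prime p -> ~~ (p %| N)%N -> (k0 < p)%N ->
  (p%:Z %| x + (k0 * N)%:Z)%Z ->
  \prod_(i < p | i != k0 :> nat) ((x + (i * N)%:Z)%:~R : 'F_p) = Fp_unit_prod p.
Proof.
move=> p_pr pN k0p px.
pose h (i : 'I_p) : 'F_p := (x + (i * N)%:Z)%:~R.
have h_inj : injective h.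
  move=> i j /eqP; rewrite -subr_eq0 -intrB Fp_intr_eq0 // => pij.
  have {}pij : (p%:Z %| (i%:Z - j%:Z) * N%:Z)%Z.
    by move: pij; congr (_ %| _)%Z; rewrite !PoszM; ring.
  move: pij; rewrite Gauss_dvdzl ?coprimezE ?prime_coprime // -eqz_mod_dvd.
  by rewrite !modz_nat !modn_small // => /eqP[/val_inj].
have h_bij : bijective h.
  by apply: inj_card_bij => //; rewrite card_Fp // card_ord.
rewrite /Fp_unit_prod (reindex h) /=; last exact: onW_bij.
apply: eq_bigl => i; congr (~~ _); rewrite /h.
apply/eqP/eqP => [->|]; first by apply/eqP; rewrite Fp_intr_eq0.
have hk : h (Ordinal k0p) = 0 by apply/eqP; rewrite Fp_intr_eq0.
by move=> hi; have /h_inj -> : h i = h (Ordinal k0p) by rewrite hk.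
Qed.

(** Each block of p consecutive factors contains a single multiple of p, located at
the same place k0 in every block, with x + k0 N = p t.  The bounds on x and
the absence of zeros force t to lie in [1, N], so t is the representative of
u x, where u is an inverse of p modulo N. *)
Lemma arith_prod_mulp p (N : nat) u x n : prime p -> ~~ (p %| N)%N ->
  `|x| < p%:Z -> (forall k : nat, x + (k * N)%:Z != 0) ->
  (N %| u * p%:Z - 1)%Z ->
  exists2 U : int, arith_prod N x (n * p) = (p ^ n)%:Z * arith_prod N (rep N (u * x)) n * U
    & (U%:~R : 'F_p) = Fp_unit_prod p ^+ n.
Proof.
move=> p_pr pN xp x_ok up.
have N0 : (0 < N)%N by case: N pN {x_ok up} => //; rewrite dvdn0.
have := dvdz_rep N (u * x); have := rep_bounds (u * x) N0.
move: (rep N (u * x)) => t /andP[t1 tN] tux.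
have /dvdzP[k0 ek0] : (N %| p%:Z * t - x)%Z.
  have -> : p%:Z * t - x = p%:Z * (t - u * x) + (u * p%:Z - 1) * x by ring.
  by rewrite rpredD //; [exact: dvdz_mull | apply: dvdz_mulr].
have ept : p%:Z * t = x + k0 * N%:Z by rewrite -ek0; ring.
have p0 : 0 < p%:Z by rewrite ltz_nat prime_gt0.
(* The integer k0 for which x + k0 N = p t lies in [0, p).  At the upper end, t = N
is the only difficulty: x would then be a nonpositive multiple of N. *)
have k0_ge0 : 0 <= k0.
  rewrite leNgt; apply/negP => k00; have : k0 * N%:Z < 0 by rewrite pmulr_llt0.
  have : p%:Z <= p%:Z * t by rewrite ler_peMr // ltW.
  by move: xp; rewrite ept; lia.
have k0_lt : k0 < p%:Z.
  rewrite ltNge; apply/negP => pk0.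
  have h1 : 0 <= (k0 - p%:Z) * N%:Z by rewrite mulr_ge0 // subr_ge0.
  have [tN'|tN'] := eqVneq t N%:Z.
    have /eqP[] := x_ok `|k0 - p%:Z|%N; rewrite PoszM gez0_abs ?subr_ge0 //.
    by rewrite tN' in ept; rewrite mulrBl ept; ring.
  have h2 : p%:Z <= p%:Z * (N%:Z - t).
    rewrite ler_peMr //; have := lt_neqAle t N; rewrite tN' tN; lia.
  by move: xp h1; rewrite mulrBl; move: h2; rewrite mulrBr ept; lia.
case: k0 k0_ge0 k0_lt ek0 ept => // k0 _ k0p _ ept.
exists (\prod_(j < n) \prod_(i < p | i != k0 :> nat) (x + ((j * p + i) * N)%:Z)).
  rewrite /arith_prod (prod_blocks n p (fun k => x + (k * N)%:Z)).
  have -> : (p ^ n)%:Z = \prod_(j < n) p%:Z by rewrite prodr_const card_ord -!natz natrX.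
  rewrite -!big_split /=; apply: eq_bigr => j _.
  rewrite (bigD1 (Ordinal k0p)) //=; congr (_ * _).
  by rewrite mulrDr ept !PoszM PoszD PoszM; ring.
rewrite rmorph_prod -[n in RHS]card_ord -prodr_const; apply: eq_bigr => j _.
rewrite rmorph_prod /= -(@Fp_arith_block p N (x + (j * p * N)%:Z) k0) //.
  by apply: eq_bigr => i _; rewrite mulnDl PoszD addrA.
rewrite addrAC rpredD //; first by rewrite PoszM -ept dvdz_mulr.
by rewrite mulnAC PoszM dvdz_mull.
Qed.

(** * Gauss congruences twist the parameters *)

Definition nonvanishing (N : nat) (s : seq int) : Prop :=
  forall x, x \in s -> forall k : nat, x + (k * N)%:Z != 0.

(** Dwork's map on numerators: for u an inverse of p modulo N, it turns the parameter
x / N into the number y / N in (0, 1] for which p (y / N) - x / N is an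
integer. *)
Definition twist (N : nat) (u : int) (x : int) : int := rep N (u * x).

(** The hypergeometric term with parameters x / N, when s and b have the same
length: the powers of N then cancel. *)
Definition arith_ratio (N : nat) (s b : seq int) : Qseries :=
  fun n => (prod_arith N s n)%:~R / (prod_arith N b n)%:~R.

Lemma prod_arith_neq0 N s n : nonvanishing N s -> prod_arith N s n != 0.
Proof.
move=> s_ok; rewrite /prod_arith big_seq prodf_seq_neq0; apply/allP => x xs.
by apply/implyP => _; apply/prodf_neq0 => k _; exact: s_ok.
Qed.

Lemma prod_arith_mulp p N u s n : prime p -> ~~ (p %| N)%N ->
  {in s, forall x, `|x| < p%:Z} -> nonvanishing N s -> (N %| u * p%:Z - 1)%Z ->
  exists2 U : int,
    prod_arith N s (n * p) =
      (p ^ n)%:Z ^+ size s * prod_arith N (map (twist N u) s) n * U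
    & (U%:~R : 'F_p) = Fp_unit_prod p ^+ n ^+ size s.
Proof.
move=> p_pr pN + + up; rewrite /prod_arith.
elim: s => [|x s IHs] sp s_ok; first by exists 1; rewrite ?big_nil ?mulr1.
have [||U eU cU] := IHs; try by move=> y ys; (apply: sp || apply: s_ok); rewrite inE ys orbT.
have [||V eV cV] := @arith_prod_mulp p N u x n p_pr pN _ _ up.
- by apply: sp; rewrite mem_head.
- by apply: s_ok; rewrite mem_head.
exists (V * U); last by rewrite intrM cU cV exprS.
by rewrite /= !big_cons eU eV exprS; ring.
Qed.

(** The common power of p and the common factor prime to p brought by
[prod_arith_mulp] cancel in the quotient, so that the Gauss congruence becomes a
congruence modulo p between the term and its twist. *)
Lemma gauss_twist_dvd p N u s b n : prime p -> ~~ (p %| N)%N -> size s = size b ->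
  {in s, forall x, `|x| < p%:Z} -> {in b, forall x, `|x| < p%:Z} ->
  nonvanishing N s -> nonvanishing N b -> (N %| u * p%:Z - 1)%Z ->
  gauss_congruences p (arith_ratio N s b) ->
  (p%:Z %| prod_arith N (map (twist N u) s) n * prod_arith N b n -
           prod_arith N s n * prod_arith N (map (twist N u) b) n)%Z.
Proof.
move=> p_pr pN szsb sp bp s_ok b_ok up /(gauss_congruences_nat _ p_pr)/(_ n)[z zp].
rewrite /arith_ratio.
have [U -> cU] := prod_arith_mulp n p_pr pN sp s_ok up.
have := prod_arith_neq0 (n * p) b_ok.
have [V -> cV] := prod_arith_mulp n p_pr pN bp b_ok up.
have := prod_arith_neq0 n b_ok.
rewrite szsb; move: (prod_arith N b n) (prod_arith N s n) => B S.
move: (prod_arith N _ n) (prod_arith N _ n) => S' B' B0.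
rewrite !mulf_eq0 !negb_or => /andP[/andP[q0 B'0] V0] e.
have /(Zlocal_dvd p_pr) : (S' * U * B - S * (B' * V))%:~R =
    p%:R * (z * ((n%:Z * B' * V * B)%:~R)) :> rat.
  move: e; rewrite !intrM rmorphB /= !intrM natrM => e.
  have q0' : ((p ^ n)%:Z ^+ size b)%:~R != 0 :> rat by rewrite intr_eq0.
  have B0' : B%:~R != 0 :> rat by rewrite intr_eq0.
  have V0' : V%:~R != 0 :> rat by rewrite intr_eq0.
  have B'0' : B'%:~R != 0 :> rat by rewrite intr_eq0.
  transitivity (n%:R * p%:R * z * (B'%:~R * V%:~R * B%:~R) : rat).
    by rewrite -e; field; rewrite q0' B0' V0' B'0'.
  by rewrite -pmulrn; ring.
have zp' : z * (n%:Z * B' * V * B)%:~R \in Zlocal p by rewrite ZlocalM // Zlocal_int.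
move=> /(_ zp'); rewrite -!Fp_intr_eq0 // !rmorphB /= !intrM cU cV szsb => E.
have c0 : Fp_unit_prod p ^+ n ^+ size b != 0 by rewrite !expf_neq0 ?Fp_unit_prod_neq0.
rewrite -(inj_eq (mulfI c0)) mulr0 -(eqP E); apply/eqP; ring.
Qed.

(** The bound depends neither on u nor on s beyond its length, since twisted
parameters lie in [1, N]. *)
Lemma abs_prod_arith_le (N : nat) u s n : (0 < N)%N ->
  (`|prod_arith N (map (twist N u) s) n| <= (n.+1 * N) ^ (n * size s))%N.
Proof.
move=> N0; rewrite /prod_arith; elim: s => [|x s IHs]; first by rewrite big_nil muln0.
rewrite /= big_cons abszM mulnS expnD leq_mul // /arith_prod.
have /andP[t1 tN] := rep_bounds (u * x) N0.
rewrite (big_morph absz abszM (erefl _)).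
have -> : ((n.+1 * N) ^ n = \prod_(k < n) (n.+1 * N))%N.
  by rewrite prod_nat_const card_ord.
elim/big_ind2: _ => // [a b c d|k _]; first exact: leq_mul.
rewrite -lez_nat gez0_abs; last by rewrite addr_ge0 // (le_trans _ t1).
rewrite /twist mulSn PoszD lerD // lez_nat leq_mul2r.
by rewrite (ltnW (ltn_ord k)) orbT.
Qed.

(** The two products are bounded independently of p and u, so that their congruence
modulo a large p is an equality. *)
Lemma gauss_twist_eq (N : nat) s b K : (0 < N)%N -> size s = size b ->
  nonvanishing N s -> nonvanishing N b ->
  exists M, forall p u, prime p -> (M < p)%N -> (N %| u * p%:Z - 1)%Z ->
  gauss_congruences p (arith_ratio N s b) ->
  forall n, (n <= K)%N ->
  prod_arith N (map (twist N u) s) n * prod_arith N b n =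
  prod_arith N s n * prod_arith N (map (twist N u) b) n.
Proof.
move=> N0 szsb s_ok b_ok.
(* M n bounds the difference of the two products; p must also exceed N, to be prime
to it, and the numerators, for the twist to land in [1, N]. *)
pose M n := ((n.+1 * N) ^ (n * size s) *
  (`|prod_arith N b n| + `|prod_arith N s n|))%N.
exists (N + \sum_(x <- s ++ b) `|x| + \sum_(n < K.+1) M n)%N => p u p_pr Mp up fG n nK.
have Np : (N < p)%N by rewrite (leq_ltn_trans _ Mp) // -addnA leq_addr.
have pN : ~~ (p %| N)%N by rewrite gtnNdvd.
have small x : x \in s ++ b -> `|x| < p%:Z.
  move=> xs; rewrite -abszE ltz_nat (leq_ltn_trans _ Mp) //.
  by rewrite (big_rem x xs) /= -addnA addnCA -addnA leq_addr.
have Mn : (M n < p)%N.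
  rewrite (leq_ltn_trans _ Mp) // (bigD1 (Ordinal (nK : (n < K.+1)%N))) //=.
  by rewrite addnCA leq_addr.
have sb_ok x : x \in s -> `|x| < p%:Z by move=> xs; rewrite small // mem_cat xs.
have bb_ok x : x \in b -> `|x| < p%:Z by move=> xs; rewrite small // mem_cat xs orbT.
have := gauss_twist_dvd n p_pr pN szsb sb_ok bb_ok s_ok b_ok up fG.
have := abs_prod_arith_le u s n N0; have := abs_prod_arith_le u b n N0.
move: Mn; rewrite /M -szsb; move: (_ ^ _)%N => Q.
move: (prod_arith N b n) (prod_arith N s n) => B S.
move: (prod_arith N _ n) (prod_arith N _ n) => S' B'.
move=> QBS B'Q S'Q dvd; apply/eqP; rewrite -subr_eq0 -absz_eq0.
have lt : (`|(S' * B - S * B')%R| < p)%N.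
  apply: leq_ltn_trans QBS; apply: (@leq_trans (`|S' * B| + `|S * B'|)); first by lia.
  by rewrite !abszM mulnDr; apply: leq_add; [exact: leq_mul | rewrite mulnC leq_mul].
apply/eqP; move: dvd lt; rewrite dvdzE /=.
by move: `|_|%N => [|k] // pk; rewrite ltnNge (dvdn_leq _ pk).
Qed.

Definition params (N : nat) (s : seq int) : seq rat := [seq x%:~R / N%:R | x <- s].

Lemma poch_prod_params (N : nat) s n : (0 < N)%N ->
  poch_prod (params N s) n = (prod_arith N s n)%:~R / N%:R ^+ n ^+ size s.
Proof.
move=> N0; have N0' : N%:R != 0 :> rat by rewrite pnatr_eq0 -lt0n.
rewrite /poch_prod /params /prod_arith big_map.
elim: s => [|x s IHs]; first by rewrite !big_nil divr1.
rewrite !big_cons IHs intrM exprS.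
have -> : pochhammer (x%:~R / N%:R) n = (arith_prod N x n)%:~R / N%:R ^+ n.
  elim: n {IHs} => [|n IHn].
    by rewrite pochhammer0 /arith_prod big_ord0 expr0 divr1.
  rewrite pochhammerS IHn /arith_prod big_ord_recr /= intrM rmorphD /= -pmulrn.
  rewrite natrM exprSr; field.
  by rewrite expf_neq0 N0'.
by rewrite invfM; ring.
Qed.

Lemma nonvanishing_of_admissible (N : nat) s : (0 < N)%N -> admissible (params N s) -> nonvanishing N s.
Proof.
move=> N0 /allP s_ok x xs k; have /s_ok := map_f (fun x : int => x%:~R / N%:R : rat) xs.
rewrite /= negb_and; apply: contraL => /eqP; rewrite -[_ + _]/(x + _) => xk.
have {xk} -> : x = - (k * N)%:Z by apply/eqP; rewrite -addr_eq0 xk.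
have N0' : N%:R != 0 :> rat by rewrite pnatr_eq0 -lt0n.
have -> : (- (k * N)%:Z)%:~R / N%:R = - (k%:R) :> rat.
  by rewrite intrN -pmulrn natrM mulNr mulfK.
by rewrite rpredN rpred_nat oppr_le0 ler0n.
Qed.

Lemma admissible_twist (N : nat) u s : (0 < N)%N -> admissible (params N (map (twist N u) s)).
Proof.
move=> N0; apply/allP => x /mapP[_ /mapP[y ys ->] ->].
rewrite /= negb_and -ltNge; apply/orP; right; rewrite divr_gt0 ?ltr0n // ltr0z.
by have /andP[t1 _] := rep_bounds (u * y) N0; exact: lt_le_trans t1.
Qed.

(** The quotients being compared are hypergeometric terms, so [poch_prod_inj]
applies to the equalities of [gauss_twist_eq] for sufficiently many n. *)
Lemma gauss_twist_perm (N : nat) s b : (0 < N)%N -> size s = size b ->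
  admissible (params N s) -> admissible (params N b) ->
  exists M, forall p u, prime p -> (M < p)%N -> (N %| u * p%:Z - 1)%Z ->
  gauss_congruences p (arith_ratio N s b) ->
  perm_eq (map (twist N u) s ++ b) (s ++ map (twist N u) b).
Proof.
move=> N0 szsb s_ok b_ok.
have [M HM] := @gauss_twist_eq N s b (size s + size b).+1 N0 szsb
  (nonvanishing_of_admissible N0 s_ok) (nonvanishing_of_admissible N0 b_ok).
exists M => p u p_pr Mp up fG.
have N0' : N%:R != 0 :> rat by rewrite pnatr_eq0 -lt0n.
have param_inj : injective (fun x : int => x%:~R / N%:R : rat).
  move=> x y /(congr1 ( *%R^~ N%:R)); rewrite !divfK // => /eqP.
  by rewrite eqr_int => /eqP.
apply: (perm_map_inj param_inj).
have [||||||//] := @poch_prod_inj (params N (map (twist N u) s) ++ params N b)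
  (params N s ++ params N (map (twist N u) b)) 1 (size s + size b).+1.
- by rewrite admissible_cat admissible_twist.
- by rewrite admissible_cat s_ok admissible_twist.
- by rewrite size_cat !size_map.
- by rewrite size_cat !size_map.
- by [].
- move=> n nK; rewrite expr1n mul1r !poch_prod_cat !poch_prod_params // !size_map.
  have := HM p u p_pr Mp up fG n nK => /(congr1 (fun x : int => x%:~R : rat)).
  by rewrite !intrM => e; rewrite -szsb !mulf_div e.
by rewrite /params -!map_cat.
Qed.

(** * Multiplicities invariant under twisting *)

(** The signed number of parameters satisfying q.  Only this difference matters,
because common parameters cancel. *)
Definition count_diff (s b : seq int) (q : pred int) : int :=
  (count q s)%:Z - (count q b)%:Z.

Definition twist_invariant (N M : nat) (s b : seq int) : Prop :=
  forall p u, prime p -> (M < p)%N -> (N %| u * p%:Z - 1)%Z ->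
  perm_eq (map (twist N u) s ++ b) (s ++ map (twist N u) b).

Lemma count_diff_twist N u s b q :
  perm_eq (map (twist N u) s ++ b) (s ++ map (twist N u) b) ->
  count_diff s b (q \o twist N u) = count_diff s b q.
Proof.
move=> /permP/(_ q); rewrite !count_cat !count_map /count_diff => e.
by apply/eqP; rewrite subr_eq addrAC eq_sym subr_eq -!PoszD e addnC.
Qed.

Lemma inverse_mod (N k : nat) : coprime k N -> exists u : int, (N %| u * k%:Z - 1)%Z.
Proof.
rewrite -[coprime _ _]/(coprimez k%:Z N%:Z) => /coprimezP[[u v] /= e].
by exists u; rewrite -e; apply/dvdzP; exists (- v); ring.
Qed.

Lemma large_prime_inverse (N M p : nat) : (0 < N)%N -> (N <= M)%N -> prime p -> (M < p)%N ->
  exists u : int, (N %| u * p%:Z - 1)%Z.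
Proof.
move=> N0 NM p_pr Mp; apply: inverse_mod; rewrite prime_coprime //.
by rewrite gtnNdvd // (leq_ltn_trans NM).
Qed.

(** Twisted parameters lie in [1, N], so q is only evaluated there after a twist. *)
Lemma count_diff_local (N M : nat) s b (q1 q2 : pred int) :
  (0 < N)%N -> (N <= M)%N -> twist_invariant N M s b ->
  (forall x, 1 <= x <= N%:Z -> q1 x = q2 x) ->
  count_diff s b q1 = count_diff s b q2.
Proof.
move=> N0 NM sbinv q12; have [p Mp p_pr] := prime_above M.
have [u up] := large_prime_inverse N0 NM p_pr Mp.
rewrite -(count_diff_twist q1 (sbinv _ _ p_pr Mp up)).
rewrite -(count_diff_twist q2 (sbinv _ _ p_pr Mp up)).
by rewrite /count_diff; congr (_%:Z - _%:Z); apply: eq_count => x /=;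
  apply: q12; exact: rep_bounds.
Qed.

(** Twisting by an inverse u of p is, on [1, N], the inverse of the bijection
y -> rep (p y). *)
Lemma count_diff_prime (N M p : nat) s b x :
  (0 < N)%N -> (N <= M)%N -> twist_invariant N M s b ->
  prime p -> (M < p)%N ->
  count_diff s b (pred1 (rep N (p%:Z * x))) = count_diff s b (pred1 (rep N x)).
Proof.
move=> N0 NM sbinv p_pr Mp; have [u up] := large_prime_inverse N0 NM p_pr Mp.
rewrite -[RHS](count_diff_twist _ (sbinv _ _ p_pr Mp up)).
apply: (count_diff_local N0 NM sbinv) => y yN; rewrite /= /twist.
have := dvdz_rep N (p%:Z * x); have := dvdz_rep N (u * y).
have := dvdz_rep N x.
move=> /dvdzP[c1 e1] /dvdzP[c2 e2] /dvdzP[c3 e3]; have /dvdzP[c4 e4] := up.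
apply/eqP/eqP => [ey|euy].
  apply: rep_eq; apply/dvdzP; rewrite ey.
  have -> : rep N (p%:Z * x) = p%:Z * x + c3 * N%:Z by rewrite -e3; ring.
  exists (c4 * x + u * c3); rewrite mulrDl.
  have -> : c4 * x * N%:Z = (u * p%:Z - 1) * x by rewrite e4; ring.
  ring.
rewrite -(rep_id yN); apply: rep_eq; apply/dvdzP.
have ex : x = u * y + (c2 - c1) * N%:Z by rewrite mulrBl -e2 -e1 euy; ring.
exists (- (c4 * y) - p%:Z * (c2 - c1)); rewrite mulrBl mulNr.
have -> : c4 * y * N%:Z = (u * p%:Z - 1) * y by rewrite e4; ring.
by rewrite [in LHS]ex; ring.
Qed.

Lemma count_diff_rough (N M k : nat) s b x :
  (0 < N)%N -> (N <= M)%N -> twist_invariant N M s b ->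
  (0 < k)%N -> (forall q, prime q -> (q %| k)%N -> (M < q)%N) ->
  count_diff s b (pred1 (rep N (k%:Z * x))) = count_diff s b (pred1 (rep N x)).
Proof.
move=> N0 NM sbinv; elim/ltn_ind: k x => k IHk x k0 rough; have [k1|k1] := leqP k 1.
  by have -> : k = 1%N by [lia]; rewrite mul1r.
have p_pr := pdiv_prime k1; have /dvdnP[k' ek] := pdiv_dvd k.
have k'0 : (0 < k')%N by move: k0; rewrite ek muln_gt0 => /andP[].
have -> : k%:Z * x = (pdiv k)%:Z * (k'%:Z * x) by rewrite {1}ek PoszM; ring.
rewrite (count_diff_prime _ N0 NM sbinv) ?rough ?pdiv_dvd //; apply: IHk => //.
  by rewrite [X in (_ < X)%N]ek ltn_Pmulr ?prime_gt1.
by move=> q q_pr qk'; apply: rough => //; rewrite ek dvdn_mulr.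
Qed.

(** Choosing for t the product of the primes up to M that do not divide a makes
each prime up to M divide exactly one of a and d t. *)
Lemma rough_progression (M a d : nat) : (0 < a)%N -> coprime a d ->
  exists2 t : nat, (0 < a + d * t)%N &
    forall q, prime q -> (q %| a + d * t)%N -> (M < q)%N.
Proof.
move=> a0 cad.
pose t := (\prod_(q < M.+1 | prime q && ~~ (q %| a)%N) q)%N.
exists t => [|q q_pr qd]; first by rewrite addn_gt0 a0.
rewrite ltnNge; apply/negP => qM.
have [qa|qa] := boolP (q %| a)%N.
  move: qd; rewrite dvdn_addr // Euclid_dvdM // => /orP[qd|].
    have := dvdn_gcd q a d; rewrite qa qd (eqP cad) dvdn1 => /eqP q1.
    by rewrite q1 in q_pr.
  rewrite /t; apply/negP; elim/big_ind: _ => [|x y qx qy|i /andP[i_pr ia]].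
  - by rewrite Euclid_dvd1.
  - by rewrite Euclid_dvdM // negb_or qx.
  by rewrite dvdn_prime2 //; apply: contraNneq ia => <-.
have qt : (q %| t)%N.
  by rewrite /t (bigD1 (Ordinal (qM : (q < M.+1)%N))) ?q_pr //= dvdn_mulr.
by move: qd; rewrite dvdn_addl ?dvdn_mull // (negPf qa).
Qed.

(** Modulo N, j is a multiple k gcd(j, N) in which k may be changed by multiples
of N / gcd(j, N); by [rough_progression], k can be taken with large prime
factors only, and multiplication by such a k changes no multiplicity. *)
Lemma count_diff_gcd (N M j : nat) s b :
  (0 < N)%N -> (N <= M)%N -> twist_invariant N M s b ->
  (0 < j <= N)%N ->
  count_diff s b (pred1 j%:Z) = count_diff s b (pred1 (gcdn j N)%:Z).
Proof.
move=> N0 NM sbinv /andP[j0 jN]; have g0 : (0 < gcdn j N)%N by rewrite gcdn_gt0 j0.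
have cop : coprime (j %/ gcdn j N) (N %/ gcdn j N).
  rewrite /coprime -(eqn_pmul2r g0) mul1n muln_gcdl.
  by rewrite (divnK (dvdn_gcdl _ _)) (divnK (dvdn_gcdr _ _)).
have jg0 : (0 < j %/ gcdn j N)%N by rewrite divn_gt0 // dvdn_leq // dvdn_gcdl.
have [t k0 rough] := rough_progression M jg0 cop.
have bnd (i : nat) : (0 < i <= N)%N -> 1 <= i%:Z <= N%:Z by [].
have gN : (gcdn j N <= N)%N by rewrite dvdn_leq ?dvdn_gcdr.
rewrite -{1}(rep_id (bnd j _)) ?j0 // -[in RHS](rep_id (bnd (gcdn j N) _)) ?g0 //.
rewrite -[RHS](count_diff_rough _ N0 NM sbinv k0 rough); congr (count_diff s b (pred1 _)).
apply: rep_eq; rewrite -PoszM mulnDl (divnK (dvdn_gcdl _ _)) mulnAC (divnK (dvdn_gcdr _ _)).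
by rewrite PoszD opprD addrA subrr sub0r rpredN PoszM dvdz_mulr.
Qed.

(** * From invariant parameters to factorial ratios *)

Lemma prod_count (N : nat) (s : seq int) (f : int -> rat) :
  {in s, forall x, 1 <= x <= N%:Z} ->
  \prod_(x <- s) f x = \prod_(1 <= j < N.+1) f j%:Z ^+ count_mem j%:Z s.
Proof.
elim: s => [|x s IHs] sN; first by rewrite big_nil big1.
rewrite big_cons IHs => [|y ys]; last by apply: sN; rewrite inE ys orbT.
have := sN x (mem_head _ _); case: x sN => // x _ /andP[x1 xN].
under [RHS]eq_bigr => j _ do rewrite /= exprD.
rewrite big_split /=; congr (_ * _); rewrite (big_rem x) /=; last first.
  by rewrite mem_index_iota; move: x1 xN; lia.
rewrite eqxx expr1 big_seq big1 ?mulr1 // => j.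
by rewrite mem_rem_uniq ?iota_uniq // inE eqz_nat eq_sym => /andP[/negPf->].
Qed.

(** A twist moves all parameters into [1, N] without changing the quotient. *)
Lemma prod_ratio_count (N M : nat) (s b : seq int) (f : int -> rat) :
  (0 < N)%N -> (N <= M)%N -> twist_invariant N M s b ->
  {in b, forall x, f x != 0} -> (forall x, 0 < x -> f x != 0) ->
  (\prod_(x <- s) f x) / (\prod_(x <- b) f x) =
  \prod_(1 <= j < N.+1) f j%:Z ^ (count_diff s b (pred1 j%:Z)).
Proof.
move=> N0 NM inv fb fpos.
have [p Mp p_pr] := prime_above M; have [u up] := large_prime_inverse N0 NM p_pr Mp.
have perm := inv p u p_pr Mp up.
have in_range t : {in map (twist N u) t, forall x, 1 <= x <= N%:Z}.
  by move=> _ /mapP[x _ ->]; exact: rep_bounds.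
have b0 : \prod_(x <- b) f x != 0.
  by rewrite big_seq prodf_seq_neq0; apply/allP => x xb; apply/implyP => _; exact: fb.
have tb0 : \prod_(x <- map (twist N u) b) f x != 0.
  rewrite big_seq prodf_seq_neq0; apply/allP => x xb; apply/implyP => _; apply: fpos.
  by have /andP[x1 _] := in_range b x xb; exact: lt_le_trans x1.
have /eqP : \prod_(x <- map (twist N u) s ++ b) f x = \prod_(x <- s ++ map (twist N u) b) f x.
  exact: perm_big.
rewrite !big_cat /= => /eqP e.
transitivity ((\prod_(x <- map (twist N u) s) f x) / (\prod_(x <- map (twist N u) b) f x)).
  by apply/eqP; rewrite eqr_div // -e.
rewrite !(prod_count f (in_range _)) -prodfV -big_split /=; apply: eq_big_nat => j /andP[j0 _].
rewrite -(count_diff_twist _ perm) /count_diff /= -!count_map.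
have fj : f j%:Z != 0 by exact: fpos.
by rewrite expfzDr // -exprnN.
Qed.

(** Moebius inversion, done by solving the triangular system for c. *)
Lemma divisor_sum_decomposition (m : nat -> int) K : exists c : nat -> int,
  forall g, (0 < g <= K)%N -> m g = \sum_(1 <= h < K.+1 | (h %| g)%N) c h.
Proof.
elim: K => [|K [c IHc]]; first by exists (fun=> 0) => g; lia.
pose d := m K.+1 - \sum_(1 <= h < K.+1 | (h %| K.+1)%N) c h.
exists (fun h => if h == K.+1 then d else c h) => g /andP[g0 gK].
rewrite big_mkcond big_nat_recr //= eqxx -big_mkcond.
have -> : \sum_(1 <= h < K.+1 | (h %| g)%N) (if h == K.+1 then d else c h) =
    \sum_(1 <= h < K.+1 | (h %| g)%N) c h.
  by rewrite big_nat_cond [RHS]big_nat_cond; apply: eq_bigr => h; case: eqVneq => //; lia.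
have [->|gK'] := eqVneq g K.+1; first by rewrite dvdnn /d addrC subrK.
rewrite gtnNdvd ?addr0 ?IHc //; lia.
Qed.

(** [factorial_hypergeom] extended to all series, in order to be closed under
termwise products and inverses. *)
Definition is_factorial (g : Qseries) : Prop :=
  exists C : rat, exists e f : seq nat,
    [/\ C != 0, positive_seq e, positive_seq f & dilate C g = factorial_ratio e f].

Lemma fact_prod_cat e e' n : fact_prod (e ++ e') n = (fact_prod e n * fact_prod e' n)%N.
Proof. by rewrite /fact_prod big_cat. Qed.

Lemma is_factorialM g h : is_factorial g -> is_factorial h ->
  is_factorial (fun n => g n * h n).
Proof.
move=> [C [e [f [C0 e0 f0 E]]]] [D [e' [f' [D0 e0' f0' E']]]].
exists (C * D), (e ++ e'), (f ++ f'); split.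
- by rewrite mulf_neq0.
- by rewrite /positive_seq all_cat; apply/andP.
- by rewrite /positive_seq all_cat; apply/andP.
apply/funext => n; rewrite factorial_ratioE !fact_prod_cat !natrM -mulf_div.
by rewrite -!factorial_ratioE -E -E' /dilate exprMn; ring.
Qed.

Lemma is_factorial1 : is_factorial (fun=> 1).
Proof.
exists 1, [::], [::]; split=> //; apply/funext => n.
by rewrite /dilate expr1n mulr1 factorial_ratioE divff // fact_prod_neq0.
Qed.

Lemma is_factorialV g : is_factorial g -> is_factorial (fun n => (g n)^-1).
Proof.
move=> [C [e [f [C0 e0 f0 E]]]]; exists C^-1, f, e; split; rewrite ?invr_eq0 //.
apply/funext => n; have /(congr1 (fun F : Qseries => (F n)^-1)) := E.
by rewrite !factorial_ratioE /dilate invf_div exprVn invfM.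
Qed.

Lemma is_factorialX g (k : int) : is_factorial g -> is_factorial (fun n => g n ^ k).
Proof.
move=> gf; have powf (k' : nat) : is_factorial (fun n => g n ^+ k').
  elim: k' => [|k' IH]; first exact: is_factorial1.
  have -> : (fun n => g n ^+ k'.+1) = (fun n => g n * g n ^+ k').
    by apply/funext => n; rewrite exprS.
  exact: is_factorialM.
by case: k => k; [exact: powf | exact/is_factorialV/powf].
Qed.

Lemma is_factorial_prod (I : Type) (r : seq I) (P : pred I) (F : I -> Qseries) :
  (forall i, P i -> is_factorial (F i)) ->
  is_factorial (fun n => \prod_(i <- r | P i) F i n).
Proof.
move=> Ff; elim: r => [|i r IHr].
  have -> : (fun n => \prod_(i <- [::] | P i) F i n) = (fun=> 1).
    by apply/funext => n; rewrite big_nil.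
  exact: is_factorial1.
have [Pi|nPi] := boolP (P i).
  have -> : (fun n => \prod_(i <- i :: r | P i) F i n) =
      (fun n => F i n * \prod_(i <- r | P i) F i n).
    by apply/funext => n; rewrite big_cons Pi.
  exact: is_factorialM (Ff _ Pi) IHr.
have -> // : (fun n => \prod_(i <- i :: r | P i) F i n) =
      (fun n => \prod_(i <- r | P i) F i n).
by apply/funext => n; rewrite big_cons (negPf nPi).
Qed.

Lemma is_factorial_mult e : (0 < e)%N -> is_factorial (poch_prod (mult_params e)).
Proof.
move=> e0; exists (e%:R ^+ e), [:: e], [::]; split=> //.
- by rewrite expf_neq0 // pnatr_eq0 -lt0n.
- by rewrite /positive_seq /= e0.
apply/funext => n; rewrite /dilate -fact_mult_pochhammer //.
by rewrite factorial_ratioE /fact_prod big_nil big_seq1 divr1.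
Qed.

Lemma prod_expz (I : Type) (r : seq I) (P : pred I) (F : I -> rat) (c : int) :
  \prod_(i <- r | P i) F i ^ c = (\prod_(i <- r | P i) F i) ^ c.
Proof. by elim/big_rec2: _ => [|i x y _ ->]; rewrite ?exp1rz // expfzMl. Qed.

Lemma prod_multiples (e h : nat) (F : nat -> rat) : (0 < h)%N ->
  \prod_(1 <= j < (e * h).+1 | (h %| j)%N) F j = \prod_(1 <= k < e.+1) F (k * h)%N.
Proof.
move=> h0; rewrite -big_filter -(big_map (muln^~ h) xpredT F).
apply: perm_big; apply: uniq_perm.
- by rewrite filter_uniq ?iota_uniq.
- by rewrite map_inj_uniq ?iota_uniq // => k l /eqP; rewrite eqn_pmul2r // => /eqP.
move=> j; rewrite mem_filter mem_index_iota; apply/andP/mapP.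
  move=> [/dvdnP[k ->]]; rewrite muln_gt0 ltnS leq_pmul2r // => /andP[/andP[k0 _] ke].
  by exists k => //; rewrite mem_index_iota k0.
move=> [k]; rewrite mem_index_iota => /andP[k0 ke] ->.
by rewrite dvdn_mull // muln_gt0 k0 h0 ltnS leq_pmul2r.
Qed.

(** The multiplicity of j is a sum of c h over the common divisors h of j and N.
Exchanging products, h contributes a power of the product over the multiples of h
up to N, that is over the parameters 1/e, 2/e, up to e/e with e = N / h. *)
Lemma twist_invariant_factorial (N M : nat) (s b : seq int) :
  (0 < N)%N -> (N <= M)%N -> twist_invariant N M s b -> admissible (params N b) ->
  is_factorial (fun n => poch_prod (params N s) n / poch_prod (params N b) n).
Proof.
move=> N0 NM inv b_ok.
have N0' : N%:R != 0 :> rat by rewrite pnatr_eq0 -lt0n.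
pose f n (x : int) : rat := pochhammer (x%:~R / N%:R) n.
have fpos n x : 0 < x -> f n x != 0.
  move=> x0; apply: pochhammer_neq0; rewrite negb_and -ltNge.
  by rewrite divr_gt0 ?orbT ?ltr0z ?ltr0n.
have fb n : {in b, forall x, f n x != 0}.
  move=> x xb; apply: pochhammer_neq0; apply: (allP b_ok).
  exact: (map_f (fun x : int => x%:~R / N%:R : rat)).
have [c cE] := divisor_sum_decomposition (fun j => count_diff s b (pred1 j%:Z)) N.
have -> : (fun n => poch_prod (params N s) n / poch_prod (params N b) n) =
    (fun n => \prod_(1 <= h < N.+1 | (h %| N)%N) poch_prod (mult_params (N %/ h)) n ^ c h).
  apply/funext => n; rewrite /poch_prod !big_map.
  rewrite (prod_ratio_count N0 NM inv (fb n) (fpos n)).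
  transitivity (\prod_(1 <= j < N.+1) \prod_(1 <= h < N.+1 | (h %| N)%N)
      (if (h %| j)%N then f n j%:Z ^ c h else 1)).
    apply: eq_big_nat => j /andP[j0 jN].
    have gN : (0 < gcdn j N <= N)%N by rewrite gcdn_gt0 j0 /=; apply: dvdn_leq (dvdn_gcdr _ _).
    rewrite (count_diff_gcd N0 NM inv) ?j0 // cE // -big_mkcondr.
    have fj : f n j%:Z != 0 by exact: fpos.
    have -> : \sum_(1 <= h < N.+1 | (h %| gcdn j N)%N) c h =
        \sum_(1 <= h < N.+1 | (h %| N)%N && (h %| j)%N) c h.
      by apply: eq_bigl => h; rewrite dvdn_gcd andbC.
    by elim/big_rec2: _ => // h x y _ <-; rewrite expfzDr.
  rewrite exchange_big /= big_nat_cond [RHS]big_nat_cond.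
  apply: eq_bigr => h /andP[/andP[h0 hN] /dvdnP[e eN]].
  rewrite -big_mkcond /= eN mulnK // prod_expz prod_multiples //; congr (_ ^ _).
  rewrite /mult_params big_map /index_iota subSS subn0; apply: eq_big_seq => k _.
  have eNq : N%:R = e%:R * h%:R :> rat by rewrite -natrM -eN.
  move: N0'; rewrite eNq mulf_eq0 negb_or => /andP[e0 h0'].
  rewrite /f eNq; congr (pochhammer _ _); rewrite -pmulrn natrM.
  by rewrite -mulf_div divff // mulr1.
have -> : (fun n => \prod_(1 <= h < N.+1 | (h %| N)%N) poch_prod (mult_params (N %/ h)) n ^ c h) =
    (fun n => \prod_(h <- iota 1 N | (h %| N)%N)
      (fun n => poch_prod (mult_params (N %/ h)) n ^ c h) n).
  by apply/funext => n; rewrite /index_iota subSS subn0.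
apply: is_factorial_prod => h hN; apply/is_factorialX/is_factorial_mult.
by rewrite divn_gt0 ?(dvdn_gt0 N0 hN) // (dvdn_leq N0 hN).
Qed.

(** * The equivalence *)

Lemma common_denominator (s : seq rat) :
  exists2 N : nat, (0 < N)%N & exists t : seq int, s = params N t.
Proof.
pose N := (\prod_(x <- s) `|denq x|)%N; have N0 : (0 < N)%N.
  by rewrite prodn_gt0 // => x; rewrite absz_gt0 denq_neq0.
exists N => //; exists [seq numq (x * N%:R) | x <- s].
rewrite /params -map_comp -[LHS]map_id; apply/eq_in_map => x xs /=.
have N0' : N%:R != 0 :> rat by rewrite pnatr_eq0 -lt0n.
suff /numqK -> : x * N%:R \is a Num.int by rewrite mulfK.
rewrite /N (big_rem x xs) /= natrM mulrA.
have -> : x * `|denq x|%:R = (numq x)%:~R by rewrite numqE -absz_denq.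
by rewrite rpredM // ?intr_int ?natr_int.
Qed.

(** The finitely many exceptional primes are absorbed in the bound beyond which primes
are used to twist. *)
Lemma factorial_of_gauss r (alpha beta : r.-tuple rat) :
  admissible alpha -> admissible beta ->
  gauss_property (hypergeom alpha beta) -> factorial_hypergeom alpha beta.
Proof.
move=> a_ok b_ok fG.
have [N N0 [t et]] := common_denominator (alpha ++ beta).
pose s := take r t; pose b := drop r t.
have ea : tval alpha = params N s.
  by rewrite /params map_take -/(params N t) -et take_size_cat ?size_tuple.
have eb : tval beta = params N b.
  by rewrite /params map_drop -/(params N t) -et drop_size_cat ?size_tuple.
have szs : size s = r by rewrite -(size_tuple alpha) ea size_map.
have szb : size b = r by rewrite -(size_tuple beta) eb size_map.
have N0' : N%:R != 0 :> rat by rewrite pnatr_eq0 -lt0n.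
have eH : hypergeom alpha beta = arith_ratio N s b.
  apply/funext => n; rewrite hypergeomE ea eb !poch_prod_params // szs szb /arith_ratio.
  by rewrite invf_div mulrA divfK ?expf_neq0.
rewrite ea in a_ok; rewrite eb in b_ok.
have szsb : size s = size b by rewrite szs szb.
have [M HM] := gauss_twist_perm N0 szsb a_ok b_ok.
have [X bad] : exists X, forall p, prime p -> (X < p)%N -> gauss_congruences p (arith_ratio N s b).
  move: fG; rewrite /gauss_property => /finite_seqP[F FE].
  exists (\sum_(p <- F) p)%N => p p_pr Fp; apply: contrapT => nG.
  have : p \in F.
    have <- : [set q | prime q /\ ~ gauss_congruences q (hypergeom alpha beta)]%classic p
        = (p \in F) by rewrite FE.
    by rewrite eH.
  by move=> pF; move: Fp; rewrite (big_rem p pF) /= ltnNge leq_addr.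
have inv : twist_invariant N (M + X + N) s b.
  move=> p u p_pr Mp up; apply: (HM p u) => //.
    by rewrite (leq_ltn_trans _ Mp) // -addnA leq_addr.
  by apply: bad => //; rewrite (leq_ltn_trans _ Mp) // addnAC leq_addl.
have := twist_invariant_factorial N0 (leq_addl _ _) inv b_ok.
rewrite -ea -eb /is_factorial /factorial_hypergeom.
have -> // : (fun n => poch_prod alpha n / poch_prod beta n) = hypergeom alpha beta.
by apply/funext => n; rewrite hypergeomE.
Qed.

(** Integrality comes with the congruence because [gauss_dilate] uses both. *)
Lemma gauss_of_factorial p (R : realType) r (alpha beta : r.-tuple rat) C e f :
  admissible alpha -> admissible beta ->
  globally_bounded R (hypergeom alpha beta) -> C != 0 ->
  positive_seq e -> positive_seq f ->
  dilate C (hypergeom alpha beta) = factorial_ratio e f -> prime p ->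
  (forall n, factorial_ratio e f n \in Zlocal p) /\
  gauss_congruences p (factorial_ratio e f).
Proof.
move=> a_ok b_ok gb C0 e0 f0 eQ p_pr.
have [_ sef] := factorial_balanced a_ok b_ok C0 e0 f0 eQ.
have [B large] := globally_bounded_Zlocal gb C0 eQ.
have int n : factorial_ratio e f n \in Zlocal p := factorial_ratio_Zlocal sef large n p_pr.
by split=> //; exact: factorial_ratio_gauss.
Qed.

Lemma gauss_property_of_factorial (R : realType) r (alpha beta : r.-tuple rat) :
  admissible alpha -> admissible beta ->
  globally_bounded R (hypergeom alpha beta) ->
  factorial_hypergeom alpha beta -> gauss_property (hypergeom alpha beta).
Proof.
move=> a_ok b_ok gb [C [e [f [C0 e0 f0 eQ]]]].
have [eC _] := factorial_balanced a_ok b_ok C0 e0 f0 eQ.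
apply: (@finite_gauss_exceptions _ (fact_const e + fact_const f)%N) => p p_pr cp.
have [int fG] := gauss_of_factorial a_ok b_ok gb C0 e0 f0 eQ p_pr.
apply: (@gauss_dilate p (fact_const f) (fact_const e) (factorial_ratio e f)) => //.
- by rewrite gtnNdvd ?fact_const_gt0 // (leq_ltn_trans _ cp) // leq_addl.
- by rewrite gtnNdvd ?fact_const_gt0 // (leq_ltn_trans _ cp) // leq_addr.
move=> n; rewrite -eQ /dilate eC mulrA -exprMn.
rewrite -[(fact_const f)%:R / _]invf_div mulVf ?expr1n ?mul1r //.
by rewrite mulf_neq0 ?invr_eq0 ?fact_const_neq0.
Qed.

Theorem theorem4 (R : realType) (r : nat) (alpha beta : r.-tuple rat)
    (halpha : forall i : 'I_r, tnth alpha i \notin nonpos_int)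
    (hbeta : forall i : 'I_r, tnth beta i \notin nonpos_int)
    (hgb : globally_bounded R (hypergeom alpha beta)) :
  (gauss_property (hypergeom alpha beta) <-> factorial_hypergeom alpha beta) /\
  (forall (C : rat) (e f : seq nat),
     C != 0 -> positive_seq e -> positive_seq f ->
     dilate C (hypergeom alpha beta) = factorial_ratio e f ->
     forall p : nat, prime p -> gauss_congruences p (factorial_ratio e f)).
Proof.
have a_ok : admissible alpha by apply/all_tnthP.
have b_ok : admissible beta by apply/all_tnthP.
split; first by split;
  [exact: factorial_of_gauss | exact: (gauss_property_of_factorial a_ok b_ok hgb)].
move=> C e f C0 e0 f0 eQ p p_pr.
by have [] := gauss_of_factorial a_ok b_ok hgb C0 e0 f0 eQ p_pr.
Qed.
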